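(* For every graded matrix, the version of Min_gens using one priority queue of columns per $y$-grade produces the same output as the LW version of Min_gens, and the version of Ker_basis using one priority queue of columns per $y$-grade produces the same output as the LW version of Ker_basis.
   Context: Let $K=\mathbb{Z}_2$. Grades are elements of $\mathbb{Z}^2$ with the partial order $(g_x,g_y)\le(h_x,h_y)$ iff $g_x\le h_x$ and $g_y\le h_y$. Lexicographic order compares $x$ first, then $y$; co-lexicographic (colex) order compares $y$ first, then $x$. **Graded matrices.** A graded matrix is a finite matrix over $K$ with a grade attached to each row and column such that whenever the $(i,j)$-entry is $1$, the grade of row $i$ is $\le$ the grade of column $j$. Rows and columns are indexed in colex order of their grades (ties ordered arbitrarily but fixed). All grades are assumed to lie in $\{1,\dots,X\}\times\{1,\dots,Y\}$. The pivot of a non-zero column is its largest row index with a non-zero entry. **Reduction.** The algorithms modify the columns of the matrix in place and maintain a partial map $\rho$ (pivot map) from row indices to column indices, initially empty. Reducing column $i$ means: while column $i$ is non-zero, with pivot $j$, and $\rho(j)$ is defined with $\rho(j)<i$, add column $\rho(j)$ to column $i$. If the loop ends with column $i$ non-zero, with pivot $j$, set $\rho(j):=i$ (possibly overwriting a previous value). In Ker_basis, every column $i$ additionally carries an auxiliary vector, initially the unit vector $e_i$; whenever column $k$ is added to column $i$, the auxiliary vector of $k$ is also added to that of $i$. **LW versions.** Traverse all grid cells $(x,y)\in\{1,\dots,X\}\times\{1,\dots,Y\}$ in lexicographic order, handling each cell as follows. - Min_gens: reduce all columns of grade $(1,y),(2,y),\dots,(x-1,y)$ in increasing index order; then reduce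 each column of grade $(x,y)$ in increasing index order, and append each such column that does not reduce to $0$ to the output list, with grade $(x,y)$. - Ker_basis: reduce all columns of grade $(1,y),\dots,(x,y)$ in increasing index order; whenever one of these columns turns from non-zero to zero during its reduction, append its auxiliary vector to the output list, with grade $(x,y)$. The output is the ordered list of graded columns produced. **Versions with one priority queue per $y$-grade.** These maintain a priority queue $Q$ of grades, ordered lexicographically, initialized with all grades of columns of the matrix, and, for each $y$-coordinate $y_0$ occurring among the column grades, a priority queue $C_{y_0}$ of column indices (ordered by index), initially empty. Queues contain no repeated entries. While $Q$ is non-empty, remove its lexicographically smallest grade $(x,y)$ and handle it as follows. Insert all indices of columns of grade $(x,y)$ into $C_y$. While $C_y$ is non-empty, remove its smallest index $i$ and reduce column $i$ (with the extension below). In Min_gens: if column $i$ is then non-zero and its grade is $(x,y)$, append it to the output list with grade $(x,y)$. In Ker_basis: if column $i$ turned from non-zero to zero during this reduction, append its auxiliary vector to the output list with grade $(x,y)$. The reduction is extended as follows: when, while handling grade $(x,y)$, the reduction of column $i$ ends with column $i$ non-zero, with pivot $j$, and $\rho(j)=k$ is already defined with $k>i$, then (besides setting $\rho(j):=i$) let $y'\ge y$ be the $y$-coordinate of the grade of column $k$; insert $k$ into $C_{y'}$ and, if $y'>y$, insert $(x,y')$ into $Q$. *)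

(* Defs.v *)
From mathcomp Require Import all_boot all_order all_algebra.

Set Implicit Arguments.
Unset Strict Implicit.
Unset Printing Implicit Defensive.

Import Order.TTheory GRing.Theory.

(* All grades lie in the grid {1..X} x {1..Y}, so their coordinates are taken
   in nat; the bounds are fields of [graded_matrix]. *)
Definition grade := (nat * nat)%type.

Definition grade_le (g h : grade) : bool := ((g : nat *p nat) <= h)%O.
Definition lex_le (g h : grade) : bool := ((g : nat *l nat) <= h)%O.
Definition colex_le (g h : grade) : bool := lex_le (g.2, g.1) (h.2, h.1).

Definition in_grid (X Y : nat) (g : grade) : bool :=
  (1 <= g.1 <= X) && (1 <= g.2 <= Y).

Record graded_matrix (m n X Y : nat) := GradedMatrix {
  entries : 'M['F_2]_(m, n);
  row_grade : 'I_m -> grade;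
  col_grade : 'I_n -> grade;
  entries_graded : forall (i : 'I_m) (j : 'I_n),
    entries i j = 1%R -> grade_le (row_grade i) (col_grade j);
  rows_colex : forall i j : 'I_m,
    i <= j -> colex_le (row_grade i) (row_grade j);
  cols_colex : forall i j : 'I_n,
    i <= j -> colex_le (col_grade i) (col_grade j);
  rows_in_grid : forall i : 'I_m, in_grid X Y (row_grade i);
  cols_in_grid : forall i : 'I_n, in_grid X Y (col_grade i)
}.

(* Programs are given by big-step relations between initial and final states;
   [while_loop guard body s s'] is an inductive, so it holds only if the loop
   started in [s] terminates. *)
Inductive while_loop (S : Type) (guard : S -> bool) (body : S -> S -> Prop) :
    S -> S -> Prop :=
| While_stop s : ~~ guard s -> while_loop guard body s s
| While_step s t s' : guard s -> body s t -> while_loop guard body t s' ->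
    while_loop guard body s s'.

Fixpoint for_each (S A : Type) (body : A -> S -> S -> Prop) (l : seq A)
    (s s' : S) : Prop :=
  if l is a :: l' then exists2 t, body a s t & for_each body l' t s'
  else s' = s.

(* A priority queue is the duplicate-free list of its entries in increasing
   order, so that its head is the smallest entry. *)
Definition enqueue (T : eqType) (le : rel T) (x : T) (q : seq T) : seq T :=
  sort le (undup (x :: q)).

Definition enqueue_all (T : eqType) (le : rel T) (xs q : seq T) : seq T :=
  foldr (enqueue le) q xs.

Definition idx_le (n : nat) (i j : 'I_n) : bool := i <= j.

(* Column [i] of [auxm] is the auxiliary vector of column [i] of [mat].  Only
   Ker_basis reads [auxm]; it has no influence on [mat] and [pmap]. *)
Record state (m n : nat) := State {
  mat : 'M['F_2]_(m, n);
  auxm : 'M['F_2]_n;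
  pmap : {ffun 'I_m -> option 'I_n}
}.

Definition pivot (m : nat) (v : 'cV['F_2]_m) : option 'I_m :=
  [pick j | (v j 0%R != 0%R) && [forall k : 'I_m, (j < k) ==> (v k 0%R == 0%R)]].

Section Reduction.

Variables m n : nat.
Implicit Types (s t : state m n) (i k : 'I_n).

Definition pivot_owner i s : option 'I_n := obind (pmap s) (pivot (col i (mat s))).

Definition add_column (p : nat) (A : 'M['F_2]_(p, n)) k i : 'M['F_2]_(p, n) :=
  \matrix_(r, c) (if c == i then A r c + A r k else A r c)%R.

Definition reducible i s : bool :=
  if pivot_owner i s is Some k then k < i else false.

Definition reduction_step i s s' : Prop :=
  exists2 k, pivot_owner i s = Some k &
    s' = State (add_column (mat s) k i) (add_column (auxm s) k i) (pmap s).

Definition reduction_loop i : state m n -> state m n -> Prop :=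
  while_loop (reducible i) (reduction_step i).

Definition set_pivot i t : state m n :=
  if pivot (col i (mat t)) is Some j then
    State (mat t) (auxm t)
      [ffun j' => if j' == j then Some i else pmap t j']
  else t.

Definition reduce i s s' : Prop :=
  exists2 t, reduction_loop i s t & s' = set_pivot i t.

(* To be evaluated at the end of the loop, before [set_pivot]. *)
Definition displaced i t : option 'I_n :=
  if pivot_owner i t is Some k then if i < k then Some k else None else None.

End Reduction.

Section Algorithms.

Variables (m n X Y : nat) (M : graded_matrix m n X Y).

Definition init_state : state m n :=
  State (entries M) 1%:M%R [ffun=> None].

Definition cols_such_that (P : pred grade) : seq 'I_n :=
  [seq i <- enum 'I_n | P (col_grade M i)].

Section Output.

(* Output columns are vectors of size [p]: p = m for Min_gens (columns of the
   matrix), p = n for Ker_basis (auxiliary vectors). *)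
Variable p : nat.

Definition output := seq ('cV['F_2]_p * grade).

(* [emit g i s s'] is what is appended to the output when the reduction of
   column [i], performed while handling grade [g], leads from [s] to [s']. *)
Definition emission := grade -> 'I_n -> state m n -> state m n -> output.

Definition reduce_emit (emit : emission) (g : grade) (i : 'I_n)
    (a b : state m n * output) : Prop :=
  reduce i a.1 b.1 /\ b.2 = a.2 ++ emit g i a.1 b.1.

Definition lex_cells : seq grade :=
  [seq (x, y) | x <- iota 1 X, y <- iota 1 Y].

Definition LW_run
    (handle : grade -> state m n * output -> state m n * output -> Prop)
    (out : output) : Prop :=
  exists s, for_each handle lex_cells (init_state, [::]) (s, out).

Record qstate := QState {
  qst : state m n;
  gradeQ : seq grade;
  colQ : nat -> seq 'I_n;
  qout : output
}.

Definition process_column (emit : emission) (g : grade) (a b : qstate) : Prop :=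
  exists i l t, [/\ colQ a g.2 = i :: l, reduction_loop i (qst a) t &
    let s' := set_pivot i t in
    let C := [fun y0 : nat => colQ a y0 with g.2 |-> l] in
    let out := qout a ++ emit g i (qst a) s' in
    b = if displaced i t is Some k then
          let y' := (col_grade M k).2 in
          QState s'
            (if g.2 < y' then enqueue lex_le (g.1, y') (gradeQ a) else gradeQ a)
            [fun y0 : nat => C y0 with y' |-> enqueue (@idx_le n) k (C y')]
            out
        else QState s' (gradeQ a) C out].

Definition process_grade (emit : emission) (a b : qstate) : Prop :=
  exists g Q, gradeQ a = g :: Q /\
    let Cy := enqueue_all (@idx_le n) (cols_such_that (pred1 g)) (colQ a g.2) in
    let a' := QState (qst a) Q
                [fun y0 : nat => colQ a y0 with g.2 |-> Cy] (qout a) in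
    while_loop (fun c => colQ c g.2 != [::]) (process_column emit g) a' b.

Definition queue_run (emit : emission) (out : output) : Prop :=
  let Q0 := enqueue_all lex_le [seq col_grade M i | i <- enum 'I_n] [::] in
  exists2 b,
    while_loop (fun c => gradeQ c != [::]) (process_grade emit)
      (QState init_state Q0 (fun=> [::]) [::]) b &
    qout b = out.

End Output.

Definition emit_nothing : emission m := fun _ _ _ _ => [::].

Definition emit_nonzero : emission m := fun g i _ s' =>
  if col i (mat s') != 0%R then [:: (col i (mat s'), g)] else [::].

Definition emit_nonzero_of_grade : emission m := fun g i s s' =>
  if col_grade M i == g then emit_nonzero g i s s' else [::].

Definition emit_kernel : emission n := fun g i s s' =>
  if (col i (mat s) != 0%R) && (col i (mat s') == 0%R)
  then [:: (col i (auxm s'), g)] else [::].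

Definition min_gens_LW_cell (g : grade) (a b : state m n * output m) : Prop :=
  exists2 c,
    for_each (reduce_emit emit_nothing g)
      (cols_such_that (fun h => (h.1 < g.1) && (h.2 == g.2))) a c &
    for_each (reduce_emit emit_nonzero g) (cols_such_that (pred1 g)) c b.

Definition ker_basis_LW_cell (g : grade) (a b : state m n * output n) : Prop :=
  for_each (reduce_emit emit_kernel g)
    (cols_such_that (fun h => (h.1 <= g.1) && (h.2 == g.2))) a b.

(* [algorithm out]: the algorithm, run on M, terminates with output [out]. *)
Definition min_gens_LW : output m -> Prop := LW_run min_gens_LW_cell.
Definition ker_basis_LW : output n -> Prop := LW_run ker_basis_LW_cell.
Definition min_gens_queue : output m -> Prop := queue_run emit_nonzero_of_grade.
Definition ker_basis_queue : output n -> Prop := queue_run emit_kernel.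

End Algorithms.

(* Main.v *)
(* After every grid cell, both versions are in exactly the same state.

   Call a column settled if it is zero or is the value of rho at its pivot.
   Reducing a settled column changes nothing, a column is settled right after its
   own reduction, and the reduction of column i can unsettle only the column k
   that i displaces from rho.  As k > i, colex order puts k into the same row of
   the grid, where k comes later in the traversal of that row, or into a higher
   row y', where the cell (x, y') is still ahead; the queues put k exactly there.
   So at each cell the queue version skips only settled columns, and the cells
   absent from Q contain no column that LW changes.  Skipped columns emit nothing:
   they do not turn to zero, and columns of the current grade are never skipped.
   Both programs are deterministic, hence one pair of agreeing runs is enough. *)
From mathcomp Require Import all_boot all_order all_algebra.
From mathcomp Require Import zify.
(* Imported last: otherwise [pmap] would be that of [seq]. *)
Require Import Defs.

Set Implicit Arguments.
Unset Strict Implicit.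
Unset Printing Implicit Defensive.

Import Order.TTheory GRing.Theory.

(** * Determinism of loops and traversals *)

Lemma while_loop_fun (S : Type) (guard : S -> bool) (body : S -> S -> Prop) :
  (forall s t t', body s t -> body s t' -> t = t') ->
  forall s t t', while_loop guard body s t -> while_loop guard body s t' -> t = t'.
Proof.
move=> body_fun s t t' st; elim: st t' => {s t} [s gF|s u t gT su _ IH] t' st'.
  by case: st' gF => // ? ? ? ->.
case: st' su gT => [{}s /negP gF _ /gF //|{}s u' {}t' _ su' ut' su _].
by apply: IH; rewrite (body_fun _ _ _ su su').
Qed.

Section ForEach.

Variables (S A : Type).
Implicit Types (body : A -> S -> S -> Prop) (l : seq A).

Lemma for_each_fun body :
  (forall a s t t', body a s t -> body a s t' -> t = t') ->
  forall l s t t', for_each body l s t -> for_each body l s t' -> t = t'.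
Proof.
move=> body_fun; elim=> [|a l IH] s t t' /=; first by move=> -> ->.
by move=> [u su ut] [u' su' ut']; apply: (IH u) => //; rewrite (body_fun _ _ _ _ su su').
Qed.

Lemma for_each_cat body l1 l2 s t :
  for_each body (l1 ++ l2) s t <->
  exists2 u, for_each body l1 s u & for_each body l2 u t.
Proof.
elim: l1 s => [|a l1 IH] s /=; first by split=> [|[u -> //]]; exists s.
split=> [[v sv /IH [u vu ut]]|[u [v sv vu] ut]].
  by exists u => //; exists v.
by exists v => //; apply/IH; exists u.
Qed.

End ForEach.

Lemma eq_in_for_each (S : Type) (A : eqType) (body body' : A -> S -> S -> Prop)
    (l : seq A) :
  (forall a s t, a \in l -> body a s t <-> body' a s t) ->
  forall s t, for_each body l s t <-> for_each body' l s t.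
Proof.
elim: l => [|a l IH] //= eq_body s t.
have{}IH := IH (fun b s t lb => eq_body b s t (mem_behead (s := a :: l) lb)).
by split=> [] [u /eq_body su /IH ut]; exists u => //; apply: su; rewrite mem_head.
Qed.

(** * The orders on grades and on column indices *)

Lemma lex_leE (g h : grade) :
  lex_le g h = (g.1 < h.1) || (g.1 == h.1) && (g.2 <= h.2).
Proof.
by case: g h => [a b] [c d]; rewrite /lex_le Order.ProdLexiOrder.lexi_pair !leEnat /=; lia.
Qed.

Lemma lex_le_total : total lex_le.
Proof. by move=> g h; rewrite !lex_leE; lia. Qed.

Lemma lex_le_trans : transitive lex_le.
Proof. by move=> g h k; rewrite !lex_leE; lia. Qed.

Lemma lex_le_anti : antisymmetric lex_le.
Proof. by move=> [a b] [c d]; rewrite !lex_leE /= => ?; congr pair; lia. Qed.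

Lemma idx_le_total n : total (@idx_le n).
Proof. by move=> i j; rewrite /idx_le; lia. Qed.

Lemma idx_le_trans n : transitive (@idx_le n).
Proof. by move=> i j k; rewrite /idx_le; lia. Qed.

Lemma idx_le_anti n : antisymmetric (@idx_le n).
Proof. by move=> i j; rewrite /idx_le -eqn_leq => /eqP/val_inj. Qed.

(** * Priority queues as sorted duplicate-free lists *)

Definition priority_queue (T : eqType) (le : rel T) (q : seq T) : bool :=
  sorted le q && uniq q.

Section PriorityQueue.

Variables (T : eqType) (le : rel T).
Hypotheses (le_total : total le) (le_trans : transitive le)
  (le_anti : antisymmetric le).

Lemma mem_enqueue x q : enqueue le x q =i x :: q.
Proof. by move=> z; rewrite mem_sort mem_undup. Qed.

Lemma mem_enqueue_all xs q : enqueue_all le xs q =i xs ++ q.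
Proof. by elim: xs => //= x xs IH z; rewrite mem_enqueue !inE IH. Qed.

Lemma priority_queue_enqueue x q : priority_queue le (enqueue le x q).
Proof. by rewrite /priority_queue sort_sorted ?sort_uniq ?undup_uniq. Qed.

Lemma priority_queue_enqueue_all xs q :
  priority_queue le q -> priority_queue le (enqueue_all le xs q).
Proof. by case: xs => //= x xs _; apply: priority_queue_enqueue. Qed.

(** The head is a minimum too, so antisymmetry identifies it with [x]. This matches the entry
    removed from a queue with the next cell or column of the LW traversal. *)
Lemma priority_queue_min x q :
    priority_queue le q -> x \in q -> {in q, forall y, le x y} ->
  exists q', [/\ q = x :: q', x \notin q' & priority_queue le q'].
Proof.
case: q => // a q /andP[/= a_q /andP[aNq q_uniq]] qx x_le.
have x_a : x = a.
  apply: le_anti; rewrite x_le ?mem_head //=.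
  move: qx; rewrite inE => /orP[/eqP ->|]; last exact/allP/order_path_min.
  by case/orP: (le_total a a).
by exists q; rewrite -x_a in aNq *; split; rewrite // /priority_queue (path_sorted a_q).
Qed.

End PriorityQueue.

(** * Termination and effect of reducing one column *)

Lemma F2_addr_neq0 (a b : 'F_2) : a != 0%R -> b != 0%R -> (a + b = 0)%R.
Proof. by case: a b => [[|[|a]] ?] [[|[|b]] ?] // _ _; apply: val_inj. Qed.

Section Reduction.

Variables m n : nat.
Implicit Types (s t : state m n) (i k : 'I_n).

Variant pivot_spec (v : 'cV['F_2]_m) : option 'I_m -> Type :=
| PivotSome j of v j 0%R != 0%R & (forall k : 'I_m, j < k -> v k 0%R = 0%R) :
    pivot_spec v (Some j)
| PivotNone of v = 0%R : pivot_spec v None.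

Lemma pivotP v : pivot_spec v (pivot v).
Proof.
rewrite /pivot; case: pickP => [j /andP[vj /forallP v0]|noP].
  by constructor=> // k jk; apply/eqP; have:= v0 k; rewrite jk.
constructor; apply/colP => j; rewrite mxE; apply/eqP/negPn/negP => vj.
case: (@arg_maxnP _ _ (fun j : 'I_m => v j 0%R != 0%R) val vj) => /= k vk k_max.
have := noP k; rewrite vk /= => /forallP[] l; apply/implyP => kl.
by apply/negPn/negP => /k_max; rewrite leqNgt kl.
Qed.

Lemma pivot_some v j : pivot v = Some j ->
  v j 0%R != 0%R /\ (forall k : 'I_m, j < k -> v k 0%R = 0%R).
Proof. by case: pivotP => // k vk v0 [<-]. Qed.

(** An invariant of the reachable states that the type [state] does not enforce. Without it an
    addition need not lower the pivot, and the loop might run forever. *)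
Definition owners_pivot s :=
  forall j k, pmap s j = Some k -> pivot (col k (mat s)) = Some j.

Lemma col_add_column p (A : 'M['F_2]_(p, n)) k i c :
  col c (add_column A k i) =
  if c == i then (col c A + col k A)%R else col c A.
Proof. by apply/colP => r; rewrite !mxE; case: eqP; rewrite // !mxE. Qed.

(** Only column [i] changes, and it is not in the pivot map: it could only own its own pivot, whose
    owner is some [k < i]. *)
Lemma owners_pivot_step i s t :
  owners_pivot s -> reducible i s -> reduction_step i s t -> owners_pivot t.
Proof.
rewrite /reducible => s_ok + [k ik ->] j l /= jl; rewrite ik => k_i.
rewrite col_add_column ifN; first exact: s_ok.
apply: contraTneq k_i => li; move: ik; rewrite /pivot_owner -li (s_ok _ _ jl) /= jl.
by case=> ->; rewrite ltnn.
Qed.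

(** The termination measure. The shift by one keeps the zero column strictly below a column with
    pivot in row 0. *)
Definition pivot_height i s :=
  if pivot (col i (mat s)) is Some j then j.+1 else 0.

(** Both columns have pivot [j]: over F_2 their entries there cancel, and all entries of larger
    index vanish in both. *)
Lemma pivot_height_step i s t :
    owners_pivot s -> reducible i s -> reduction_step i s t ->
  pivot_height i t < pivot_height i s.
Proof.
rewrite /reducible => s_ok + [k ik ->]; rewrite ik => ki.
move: ik; rewrite /pivot_owner /pivot_height; case ij: (pivot _) => [j|] //= jk.
rewrite col_add_column eqxx; case: pivotP => // l; rewrite mxE ltnS.
have [wj w0] := pivot_some (s_ok _ _ jk).
have [vj v0] := pivot_some ij => vwl _.
rewrite ltnNge leq_eqVlt; apply: contra vwl => /orP[/eqP/val_inj <-|jl].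
  by rewrite F2_addr_neq0.
by rewrite v0 // w0 // addr0.
Qed.

Lemma reduction_loop_exists i s : owners_pivot s -> exists t, reduction_loop i s t.
Proof.
elim: (pivot_height i s).+1 {-2}s (ltnSn (pivot_height i s)) => // h IH {}s hs s_ok.
have [red|] := boolP (reducible i s); last by exists s; constructor.
have [u su] : exists u, reduction_step i s u.
  move: red; rewrite /reducible; case ik: pivot_owner => [k|] // _.
  by eexists; exists k.
have [|//|t ut] := IH u; last by exists t; apply: While_step su ut.
  exact: leq_trans (pivot_height_step s_ok red su) hs.
exact: owners_pivot_step su.
Qed.

Lemma reduction_loop_spec i s t : reduction_loop i s t -> owners_pivot s ->
  [/\ owners_pivot t, pmap t = pmap s, ~~ reducible i t &
      forall c, c != i -> col c (mat t) = col c (mat s)].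
Proof.
elim=> {s t} [s //|s u t red su _ IH] s_ok.
have [t_ok -> -> cols] := IH (owners_pivot_step s_ok red su).
case: su cols => k _ -> /= cols; split=> // c ci.
by rewrite cols // col_add_column (negPf ci).
Qed.

Definition settled i s :=
  if pivot (col i (mat s)) is Some j then pmap s j == Some i else true.

Lemma settled_reduction_loop i s : settled i s -> reduction_loop i s s.
Proof.
move=> si; constructor; move: si; rewrite /settled /reducible /pivot_owner.
by case: pivot => // j /eqP /= ->; rewrite ltnn.
Qed.

Lemma settled_set_pivot i s : settled i s -> set_pivot i s = s.
Proof.
rewrite /settled /set_pivot; case: pivot => // j /eqP si; case: s si => A B f /= si.
by congr State; apply/ffunP => j'; rewrite ffunE; case: eqP => // ->.
Qed.

Lemma settled_reduce i s : settled i s -> reduce i s s.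
Proof.
by move=> si; exists s; rewrite ?settled_set_pivot //; apply: settled_reduction_loop.
Qed.

Lemma mat_set_pivot i t : mat (set_pivot i t) = mat t.
Proof. by rewrite /set_pivot; case: pivot. Qed.

Lemma pmap_set_pivot i t j : pmap (set_pivot i t) j =
  if pivot (col i (mat t)) == Some j then Some i else pmap t j.
Proof.
rewrite /set_pivot; case: pivot => [j'|] //=; rewrite ffunE eq_sym.
by rewrite -[Some j' == _]/(j' == j).
Qed.

Section ReductionResult.

Variables (i : 'I_n) (s t : state m n).
Hypotheses (s_ok : owners_pivot s) (st : reduction_loop i s t).

Lemma owners_pivot_reduce : owners_pivot (set_pivot i t).
Proof.
have [t_ok _ _ _] := reduction_loop_spec st s_ok.
move=> j k; rewrite pmap_set_pivot mat_set_pivot; case: eqP => [ij [<-] //|_].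
exact: t_ok.
Qed.

Lemma settled_reduced : settled i (set_pivot i t).
Proof.
rewrite /settled mat_set_pivot; case ij: pivot => [j|] //.
by rewrite pmap_set_pivot ij eqxx.
Qed.

Lemma pmap_reduce j k :
  pmap (set_pivot i t) j = Some k -> k = i \/ pmap s j = Some k.
Proof.
have [_ <- _ _] := reduction_loop_spec st s_ok.
by rewrite pmap_set_pivot; case: eqP => [_ [->]|]; [left | right].
Qed.

(** Membership in the old pivot map is what gives access to [inv_owner_done]: a displaced column has
    a grade that was already reached. *)
Lemma displacedP k : displaced i t = Some k -> i < k /\ exists j, pmap s j = Some k.
Proof.
have [_ <- _ _] := reduction_loop_spec st s_ok.
rewrite /displaced /pivot_owner; case: pivot => //= j; case jk: (pmap t j) => [l|] //.
by case: ifP => // il [<-]; split=> //; exists j.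
Qed.

(** For [k != i], column [k] itself is unchanged, so it can only lose its pivot to [i]. The loop
    guard being false then excludes [k < i], and [i < k] means that [k] is displaced. *)
Lemma settled_reduce_other k :
  displaced i t != Some k -> settled k s -> settled k (set_pivot i t).
Proof.
have [->|ki] := eqVneq k i; first by rewrite settled_reduced.
have [t_ok pmap_t red_t col_t] := reduction_loop_spec st s_ok.
rewrite /settled mat_set_pivot col_t //; case kj: (pivot (col k _)) => [j|] //.
move=> k_kept /eqP jk; rewrite pmap_set_pivot -pmap_t in jk *.
case: (pivot _ =P Some j) => [ij|_]; last exact/eqP.
move: red_t k_kept; rewrite /reducible /displaced /pivot_owner ij /= jk.
by case: ltngtP ki => [||/val_inj ->]; rewrite ?eqxx.
Qed.

End ReductionResult.

Lemma reduction_step_fun i s t t' :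
  reduction_step i s t -> reduction_step i s t' -> t = t'.
Proof. by move=> [k ik ->] [k' ik' ->]; move: ik'; rewrite ik => -[->]. Qed.

Lemma reduction_loop_fun i s t t' :
  reduction_loop i s t -> reduction_loop i s t' -> t = t'.
Proof. exact/while_loop_fun/reduction_step_fun. Qed.

Lemma reduce_fun i s t t' : reduce i s t -> reduce i s t' -> t = t'.
Proof. by move=> [u su ->] [u' su' ->]; rewrite (reduction_loop_fun su su'). Qed.

End Reduction.

(** * Increasing enumerations of columns and grid cells *)

Section Simulation.

Variables (m n X Y : nat) (M : graded_matrix m n X Y).

Lemma mem_cols_such_that (P : pred grade) k : (k \in cols_such_that M P) = P (col_grade M k).
Proof. by rewrite mem_filter mem_enum andbT. Qed.

Lemma cols_such_that_increasing (P : pred grade) :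
  pairwise (fun i j : 'I_n => i < j) (cols_such_that M P).
Proof.
apply: pairwise_filter.
rewrite -(@pairwise_map _ _ (@nat_of_ord n) ltn) val_enum_ord.
by rewrite -(sorted_pairwise ltn_trans) iota_ltn_sorted.
Qed.

Lemma mem_lex_cells h : (h \in lex_cells X Y) = in_grid X Y h.
Proof.
apply/allpairsP/idP => [[[x y] /= [+ + ->]]|hXY].
  by rewrite !mem_iota /in_grid /=; lia.
by case: h hXY => x y; rewrite /in_grid => /= xy; exists (x, y); rewrite !mem_iota; split=> //=; lia.
Qed.

Lemma lex_cells_increasing : pairwise (fun g h => ~~ lex_le h g) (lex_cells X Y).
Proof.
have ltn_iota N : pairwise ltn (iota 1 N).
  by rewrite -(sorted_pairwise ltn_trans) iota_ltn_sorted.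
rewrite /lex_cells; elim: (iota 1 X) (ltn_iota X) => //= x xs IH /andP[/allP x_xs /IH xs_ok].
rewrite pairwise_cat xs_ok andbT; apply/andP; split.
  apply/allrelP => _ _ /mapP[y _ ->] /allpairsP[[x' y'] /= [/x_xs xx' _ ->]].
  by rewrite lex_leE /=; move: xx'; rewrite /=; lia.
rewrite pairwise_map; apply: sub_pairwise (ltn_iota Y) => y y' /=.
by rewrite lex_leE /=; lia.
Qed.

(** The enumeration is strictly increasing and covers the grid. Being still ahead thus becomes
    arithmetic on coordinates. *)
Lemma mem_cells_after g prev next h : lex_cells X Y = prev ++ g :: next ->
  (h \in next) = in_grid X Y h && ~~ lex_le h g.
Proof.
move=> cells; have := lex_cells_increasing.
rewrite -mem_lex_cells cells pairwise_cat /= mem_cat inE => /and4P[].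
move=> /allrelP prev_next _ /allP g_next _.
have [/g_next ->|hNnext] := boolP (h \in next); first by rewrite !orbT.
rewrite orbF; apply/esym/negbTE; rewrite negb_and negbK.
have [h_prev|//] := boolP (h \in prev); last first.
  by have [->|] //= := eqVneq h g; rewrite lex_leE eqxx leqnn orbT.
have := prev_next h g h_prev (mem_head _ _).
by have := lex_le_total h g; case: (lex_le h g); case: (lex_le g h); rewrite ?orbT.
Qed.

(** * Determinism of both algorithms, for an arbitrary emission *)

Section Emission.

Variables (p : nat) (emit : emission m n p).

Lemma reduce_emit_fun g i a b b' :
  reduce_emit emit g i a b -> reduce_emit emit g i a b' -> b = b'.
Proof.
case: b b' => [t o] [t' o'] [/= at_ ->] [/= at' ->].
by rewrite (reduce_fun at_ at').
Qed.

Lemma process_column_fun g a b b' :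
  process_column M emit g a b -> process_column M emit g a b' -> b = b'.
Proof.
move=> [i [l [t [il it ->]]]] [i' [l' [t']]]; rewrite il => -[[<- <-] it' ->].
by rewrite (reduction_loop_fun it it').
Qed.

Lemma process_grade_fun a b b' :
  process_grade M emit a b -> process_grade M emit a b' -> b = b'.
Proof.
move=> [g [Q [aQ /= ab]]] [g' [Q' []]]; rewrite aQ => -[<- <-] /=.
by apply: while_loop_fun ab; apply: process_column_fun.
Qed.

Lemma queue_run_fun o o' : queue_run M emit o -> queue_run M emit o' -> o = o'.
Proof.
move=> [b run <-] [b' run' <-].
by rewrite (while_loop_fun process_grade_fun run run').
Qed.

Definition row_columns (g : grade) : seq 'I_n :=
  cols_such_that M (fun h => (h.1 <= g.1) && (h.2 == g.2)).

(** The common form of both LW algorithms, which then differ only in [emit]: Ker_basis has it by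
    conversion, Min_gens by [min_gens_LW_cellE]. *)
Definition LW_cell (g : grade) : state m n * output p -> state m n * output p -> Prop :=
  for_each (reduce_emit emit g) (row_columns g).

Lemma LW_run_fun o o' : LW_run M LW_cell o -> LW_run M LW_cell o' -> o = o'.
Proof.
move=> [s so] [s' so'].
have cell_fun : forall g a b b', LW_cell g a b -> LW_cell g a b' -> b = b'.
  by move=> g; apply/for_each_fun/reduce_emit_fun.
by case: (for_each_fun cell_fun so so').
Qed.

(* [next] lists the cells that are still to be handled, and [busy] is the
   y-grade whose queue is being emptied, if any. *)
Record queue_invariant (busy : option nat) (next : seq grade) (a : qstate m n p) :
    Prop := QueueInvariant {
  inv_owners : owners_pivot (qst a);
  inv_owner_done : forall j k, pmap (qst a) j = Some k -> col_grade M k \notin next;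
  inv_gradeQ : priority_queue lex_le (gradeQ a);
  inv_gradeQ_next : {subset gradeQ a <= next};
  inv_pending : forall k, col_grade M k \in next -> col_grade M k \in gradeQ a;
  inv_done : forall k, col_grade M k \notin next ->
    settled k (qst a) \/ k \in colQ a (col_grade M k).2;
  inv_colQ : forall y, priority_queue (@idx_le n) (colQ a y);
  inv_colQ_done : forall y k, k \in colQ a y ->
    (col_grade M k).2 = y /\ col_grade M k \notin next;
  inv_scheduled : forall h, h \in next -> Some h.2 != busy -> colQ a h.2 != [::] ->
    exists2 g, g \in gradeQ a & g.2 = h.2 /\ lex_le g h
}.

Lemma seq_neq0 (T : eqType) (q : seq T) : q != [::] -> exists x, x \in q.
Proof. by case: q => // x q _; exists x; rewrite mem_head. Qed.

(** * Simulation inside one grid cell *)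

Section Cell.

Variables (g : grade) (next : seq grade).
Hypotheses (g_grid : in_grid X Y g)
  (mem_next : forall h, (h \in next) = in_grid X Y h && ~~ lex_le h g).

Lemma col_done k : (col_grade M k \notin next) = lex_le (col_grade M k) g.
Proof. by rewrite mem_next cols_in_grid negbK. Qed.

(** Only two columns need care: [c], which leaves its queue but is settled by its reduction, and the
    displaced one, which is queued again. The last clause records what the row being emptied can
    gain. *)
Lemma process_column_invariant a c C t :
    queue_invariant (Some g.2) next a -> colQ a g.2 = c :: C ->
    reduction_loop c (qst a) t ->
  exists b, [/\ process_column M emit g a b, qst b = set_pivot c t,
    qout b = qout a ++ emit g c (qst a) (set_pivot c t),
    queue_invariant (Some g.2) next b &
    forall k, k \in colQ b g.2 =
      (k \in C) || (displaced c t == Some k) && ((col_grade M k).2 == g.2)].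
Proof.
move=> inv aC ct; have s_ok := inv_owners inv.
pose Cs y := if y == g.2 then C else colQ a y.
have [c_y c_done] : (col_grade M c).2 = g.2 /\ col_grade M c \notin next.
  by apply: (inv_colQ_done inv); rewrite aC mem_head.
have [cNC CsP] : c \notin C /\ (forall y, priority_queue (@idx_le n) (Cs y)).
  have /andP[] := inv_colQ inv g.2; rewrite aC /= => /path_sorted C_srt /andP[cNC C_uniq].
  by split=> // y; rewrite /Cs; case: eqP => _; rewrite ?(inv_colQ inv) // /priority_queue C_srt.
(* From here on the queues of [b] are known only through membership and sortedness. *)
have [b [ab b_st b_out [b_Q b_C b_QP b_CP]]] : exists b, [/\ process_column M emit g a b,
    qst b = set_pivot c t, qout b = qout a ++ emit g c (qst a) (set_pivot c t) &
    [/\ forall h, (h \in gradeQ b) = (h \in gradeQ a) ||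
          (if displaced c t is Some k then
             (g.2 < (col_grade M k).2) && (h == (g.1, (col_grade M k).2)) else false),
        forall y k, (k \in colQ b y) =
          (k \in Cs y) || (displaced c t == Some k) && ((col_grade M k).2 == y),
        priority_queue lex_le (gradeQ b) &
        forall y, priority_queue (@idx_le n) (colQ b y)]].
  eexists; split; first by exists c, C, t; split=> //=.
  - by case: displaced.
  - by case: displaced.
  case: displaced => [k|] /=; last first.
    split=> [h|y k||y]; rewrite ?orbF //; first exact: inv_gradeQ inv.
    exact: CsP.
  split=> [h|y l||y].
  - by case: ifP => _; rewrite ?orbF // mem_enqueue inE orbC.
  - rewrite -/(Cs y) -[Some k == _]/(k == l); have [->|yk] := eqVneq y (col_grade M k).2.
      rewrite mem_enqueue inE -/(Cs _) orbC eq_sym.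
      by have [->|] := eqVneq k l; rewrite ?eqxx.
    by have [<-|] := eqVneq k l; rewrite ?orbF //= eq_sym (negPf yk) orbF.
  - by case: ifP => _; rewrite ?(inv_gradeQ inv) ?priority_queue_enqueue //; exact: lex_le_total.
  - case: eqP => _; last exact: CsP.
    by apply: priority_queue_enqueue; exact: idx_le_total.
exists b; split=> // [|k]; last by rewrite b_C /Cs eqxx.
have displaced_done k : displaced c t = Some k -> c < k /\ col_grade M k \notin next.
  by case/(displacedP s_ok ct) => ck [j /(inv_owner_done inv)].
split=> //.
- by rewrite b_st; apply: owners_pivot_reduce ct.
- by move=> j k; rewrite b_st => /(pmap_reduce s_ok ct)[->|/(inv_owner_done inv)].
- move=> h; rewrite b_Q => /orP[/(inv_gradeQ_next inv) //|].
  (* The new entry takes its coordinates from [g] and from a column grade, so it lies in the grid;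
     its row is higher, so it comes after [g]. *)
  case: displaced => // k /andP[gk /eqP ->]; rewrite mem_next lex_leE /=.
  by move: g_grid (cols_in_grid M k); rewrite /in_grid /=; lia.
- by move=> k /(inv_pending inv) kQ; rewrite b_Q kQ.
- move=> k k_done; rewrite b_st b_C eqxx andbT.
  have [_|k_kept] := eqVneq (displaced c t) (Some k); first by rewrite orbT; right.
  rewrite orbF; have [k_s|] := inv_done inv k_done.
    by left; apply: (settled_reduce_other s_ok ct).
  rewrite /Cs; case: eqP => [->|_]; last by right.
  rewrite aC inE => /orP[/eqP ->|]; last by right.
  by left; apply: settled_reduced.
- move=> y k; rewrite b_C => /orP[|/andP[/eqP/displaced_done[_ k_done] /eqP k_y]]; last by [].
  rewrite /Cs; case: eqP => [-> kC|_]; last exact: (inv_colQ_done inv).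
  by apply: (inv_colQ_done inv); rewrite aC inE kC orbT.
- move=> h h_next h_g /seq_neq0[k]; rewrite b_C /Cs ifN //.
  case/orP=> [k_h|/andP[/eqP ck /eqP k_h]].
    have [|g' Qg' g'h] := inv_scheduled inv h_next h_g.
      by apply: contraTneq k_h => ->.
    by exists g'; rewrite // b_Q Qg'.
  (* Colex order and [h.2 != g.2] put [k] in a row above that of [g], so [(g.1, h.2)] has just been
     enqueued. It is at most [h] because [h] comes after [g]. *)
  have [{}c_k _] := displaced_done _ ck.
  have := cols_colex M (ltnW c_k); rewrite /colex_le lex_leE /= c_y k_h => gh.
  move: h_g h_next; rewrite -[_ == _]/(h.2 == g.2) mem_next lex_leE => h_g h_next.
  exists (g.1, h.2); last by rewrite lex_leE /=; split=> //; lia.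
  by rewrite b_Q ck k_h eqxx andbT; apply/orP; right; lia.
Qed.

(** Restricted to other grades because Min_gens emits a non-zero column of the current grade even
    when its reduction changes nothing. *)
Hypothesis emit_idle : forall i s, col_grade M i != g -> emit g i s s = [::].

(** Induction on the part [L] of the row that LW has yet to reduce. Upward closure keeps displaced
    columns of this row inside [L]; the last hypothesis prevents skipping columns of grade [g]. *)
Lemma cell_simulation L a :
    queue_invariant (Some g.2) next a ->
    pairwise (fun i j : 'I_n => i < j) L -> {subset L <= row_columns g} ->
    (forall c k, c \in L -> k \in row_columns g -> c < k -> k \in L) ->
    {subset colQ a g.2 <= L} ->
    (forall c, c \in L -> col_grade M c = g -> c \in colQ a g.2) ->
  exists b, [/\ for_each (reduce_emit emit g) L (qst a, qout a) (qst b, qout b),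
    while_loop (fun c => colQ c g.2 != [::]) (process_column M emit g) a b &
    queue_invariant None next b].
Proof.
elim: L a => [|c L IH] a inv L_incr L_row L_up aL La.
  have aC : colQ a g.2 = [::] by case: (colQ a g.2) aL => // k q /(_ k (mem_head _ _)).
  exists a; split=> //; first by apply: While_stop; rewrite aC.
  case: (inv) => *; split=> // h h_next _ h_a.
  by apply: (inv_scheduled inv h_next) => //; apply: contraNneq h_a => -[->]; rewrite aC.
move: L_incr => /= /andP[/allP c_L L_incr].
have{} L_row' : {subset L <= row_columns g} by move=> k kL; rewrite L_row // inE kL orbT.
have L_up' d k : d \in L -> k \in row_columns g -> d < k -> k \in L.
  move=> dL kR dk; have := L_up d k; rewrite !inE dL orbT => /(_ isT kR dk).
  by case/orP=> // /eqP kc; have := c_L _ dL; rewrite -kc; lia.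
have [cC|cNC] := boolP (c \in colQ a g.2).
  (* The queue lies within the increasing list [c :: L], so [c] is the entry it removes. *)
  have [|C [aC cNC _]] := priority_queue_min (@idx_le_total n) (@idx_le_trans n) (@idx_le_anti n)
    (inv_colQ inv g.2) cC.
    by move=> k /aL; rewrite inE => /orP[/eqP ->|/c_L]; rewrite /idx_le //; apply: ltnW.
  have [t ct] := reduction_loop_exists c (inv_owners inv).
  have [b [ab b_st b_out b_inv b_C]] := process_column_invariant inv aC ct.
  have [||d [bd d_loop d_inv]] := IH b b_inv L_incr L_row' L_up'.
  - move=> k; rewrite b_C => /orP[kC|/andP[/eqP ck /eqP k_y]].
      have := aL k; rewrite aC !inE kC orbT => /(_ isT) /orP[/eqP kc|//].
      by rewrite -kc kC in cNC.
    have [c_k [j jk]] := displacedP (inv_owners inv) ct ck.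
    (* Not being ahead, a displaced column of row [g.2] has x-grade at most [g.1]; it thus belongs
       to [row_columns g]. *)
    have := inv_owner_done inv jk; rewrite col_done lex_leE k_y => k_x.
    have := L_up c k (mem_head _ _); rewrite mem_cols_such_that k_y => /(_ _ c_k).
    rewrite inE => /(_ ltac:(lia)) /orP[/eqP kc|//]; move: c_k; rewrite kc; lia.
  - move=> k kL kg; rewrite b_C; apply/orP; left.
    have := La k; rewrite aC !inE kL orbT => /(_ isT kg) /orP[/eqP kc|//].
    by have := c_L _ kL; rewrite kc; lia.
  exists d; split=> //; last by apply: While_step ab d_loop; rewrite aC.
  by exists (qst b, qout b) => //; split=> //=; rewrite b_st //; exists t.
(* The queue version skips [c]: its cell is reached and it is not queued, so LW reduces it without
   effect. *)
have c_s : settled c (qst a).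
  have := L_row c (mem_head _ _); rewrite mem_cols_such_that => /andP[c_x /eqP c_y].
  have [|//|] := inv_done inv (k := c); rewrite ?c_y ?(negPf cNC) //.
  by rewrite col_done lex_leE c_y; lia.
have [||b [ab b_loop b_inv]] := IH a inv L_incr L_row' L_up'.
- move=> k kC; have := aL _ kC; rewrite inE => /orP[/eqP kc|//].
  by rewrite -kc kC in cNC.
- by move=> k kL; apply: La; rewrite inE kL orbT.
exists b; split=> //; exists (qst a, qout a) => //; split=> /=; first exact: settled_reduce.
rewrite emit_idle ?cats0 //; apply: contra cNC => /eqP; apply: La; exact: mem_head.
Qed.

(** Describing the queues by membership lets [a'] be either the state after [g] is removed from the
    grade queue or, if [g] is not there, [a] itself. *)
Lemma cell_pass a a' :
    queue_invariant None (g :: next) a -> qst a' = qst a ->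
    priority_queue lex_le (gradeQ a') ->
    (forall h, (h \in gradeQ a') = (h \in gradeQ a) && (h != g)) ->
    (forall y, priority_queue (@idx_le n) (colQ a' y)) ->
    (forall y k, (k \in colQ a' y) = (k \in colQ a y) || (y == g.2) && (col_grade M k == g)) ->
  exists b, [/\ LW_cell g (qst a', qout a') (qst b, qout b),
    while_loop (fun c => colQ c g.2 != [::]) (process_column M emit g) a' b &
    queue_invariant None next b].
Proof.
move=> inv a'_st a'_QP a'_Q a'_CP a'_C.
have gN : g \notin next by rewrite mem_next lex_leE eqxx leqnn orbT andbF.
have done_g k : col_grade M k \notin next ->
    col_grade M k \notin g :: next \/ col_grade M k = g.
  by move=> kN; rewrite inE (negPf kN) orbF; case: eqP; [right | left].
have done_colQ y k : k \in colQ a' y -> (col_grade M k).2 = y /\ col_grade M k \notin next.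
  rewrite a'_C => /orP[/(inv_colQ_done inv)[k_y]|/andP[/eqP -> /eqP ->] //].
  by rewrite inE negb_or => /andP[].
apply: cell_simulation; last 1 first.
- by move=> c _ cg; rewrite a'_C cg !eqxx orbT.
- split=> //.
  + by rewrite a'_st; apply: inv_owners inv.
  + move=> j k; rewrite a'_st => /(inv_owner_done inv).
    by rewrite inE negb_or => /andP[].
  + move=> h; rewrite a'_Q => /andP[/(inv_gradeQ_next inv)].
    by rewrite inE => /orP[-> //|].
  + move=> k k_next; rewrite a'_Q (inv_pending inv) /=; last by rewrite inE k_next orbT.
    by apply: contraNneq gN => <-.
  + move=> k /done_g[/(inv_done inv)|kg]; rewrite a'_st a'_C.
      by case=> [|->]; [left | right].
    by right; rewrite kg !eqxx orbT.
  + move=> h h_next h_g /seq_neq0[k]; rewrite a'_C -[h.2 == g.2]/(Some h.2 == Some g.2).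
    rewrite (negPf h_g) orbF => k_h.
    have [|//||h' Qh' [h'_y h'_h]] := inv_scheduled inv (h := h).
    * by rewrite inE h_next orbT.
    * by apply: contraTneq k_h => ->.
    (* Removing [g] cannot remove the witness, which lies in a different row. *)
    exists h' => //; rewrite a'_Q Qh'; apply: contraNneq h_g => h'g.
    by rewrite -h'_y h'g.
- exact: cols_such_that_increasing.
- by [].
- by [].
- move=> k /done_colQ[k_y]; rewrite col_done lex_leE k_y mem_cols_such_that k_y; lia.
Qed.

End Cell.

(** * Simulation over the whole grid *)

Hypothesis emit_idle : forall g i s, col_grade M i != g -> emit g i s s = [::].

Lemma cells_simulation next prev a :
    lex_cells X Y = prev ++ next -> queue_invariant None next a ->
  exists b, for_each LW_cell next (qst a, qout a) (qst b, qout b) /\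
    while_loop (fun c => gradeQ c != [::]) (process_grade M emit) a b.
Proof.
elim: next prev a => [|g next IH] prev a cells inv.
  exists a; split=> //; apply: While_stop.
  by case: (gradeQ a) (inv_gradeQ_next inv) => // h q /(_ h (mem_head _ _)).
have mem_next h := mem_cells_after h cells.
have g_grid : in_grid X Y g by rewrite -mem_lex_cells cells mem_cat mem_head orbT.
have [gQ|gNQ] := boolP (g \in gradeQ a).
  have [h|Q [aQ gNQ QP]] := priority_queue_min lex_le_total lex_le_trans lex_le_anti
    (inv_gradeQ inv) gQ.
    move/(inv_gradeQ_next inv); rewrite inE => /orP[/eqP ->|].
      by rewrite lex_leE eqxx leqnn orbT.
    by rewrite mem_next => /andP[_]; have := lex_le_total g h; case: (lex_le g h) => //= ->.
  set cols := enqueue_all (@idx_le n) (cols_such_that M (pred1 g)) (colQ a g.2).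
  set a' := QState (qst a) Q [fun y0 : nat => colQ a y0 with g.2 |-> cols] (qout a).
  have [||h|y|y k|b [ab b_loop b_inv]] := cell_pass g_grid mem_next (@emit_idle g) inv (a' := a').
  - by [].
  - by [].
  - rewrite aQ inE /=; case: eqVneq => [->|_]; last by rewrite andbT.
    by rewrite (negPf gNQ) andbF.
  - rewrite /=; case: eqP => _; last exact: inv_colQ inv _.
    exact/priority_queue_enqueue_all/(inv_colQ inv)/idx_le_total.
  - rewrite /=; case: eqP => [->|_]; last by rewrite orbF.
    by rewrite mem_enqueue_all mem_cat mem_cols_such_that orbC.
  have [|d [bd d_loop]] := IH (rcons prev g) b _ b_inv; first by rewrite cat_rcons.
  exists d; split; first by exists (qst b, qout b).
  apply: (While_step (t := b)) => //; first by rewrite aQ.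
  by exists g, Q.
(* Otherwise [inv_scheduled] gives an entry of the grade queue at most [g]; as no entry precedes
   [g], it would be [g] itself. *)
have aC : colQ a g.2 = [::].
  apply/eqP; apply: contraNT gNQ => aC.
  have [|//|//|h hQ [h_y hg]] := inv_scheduled inv (h := g); first exact: mem_head.
  have := inv_gradeQ_next inv hQ; rewrite inE => /orP[/eqP <- //|].
  by rewrite mem_next hg andbF.
have [||h|y|y k|b [ab b_loop b_inv]] := cell_pass g_grid mem_next (@emit_idle g) inv (a' := a).
- by [].
- exact: inv_gradeQ inv.
- by case: eqVneq => [->|]; rewrite ?andbT ?andbF ?(negPf gNQ).
- exact: inv_colQ inv _.
- rewrite andbC; case: eqP => [kg|]; last by rewrite orbF.
  by move: gNQ; rewrite -kg (inv_pending inv) // kg mem_head.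
(* On an empty queue the loop stops at once, so the LW pass over this cell changes neither state nor
   output. *)
have ba : b = a by case: b_loop aC => // s t s' /[swap] _ /[swap] _ /[swap] ->.
rewrite ba in ab b_inv; have [|d [bd d_loop]] := IH (rcons prev g) a _ b_inv.
  by rewrite cat_rcons.
by exists d; split=> //; exists (qst a, qout a).
Qed.

Lemma LW_queue_agree :
  exists out, forall o, (LW_run M LW_cell o <-> o = out) /\ (queue_run M emit o <-> o = out).
Proof.
set Q0 := enqueue_all lex_le [seq col_grade M i | i <- enum 'I_n] [::].
have memQ0 h : (h \in Q0) = (h \in [seq col_grade M i | i <- enum 'I_n]).
  by rewrite mem_enqueue_all cats0.
pose a := QState (init_state M) Q0 (fun=> [::]) [::] : qstate m n p.
have [|b [LW_b queue_b]] := @cells_simulation (lex_cells X Y) [::] a erefl.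
  (* Initially the pivot map is empty and every column grade is still ahead, so the clauses on
     owners and on reached columns hold vacuously. *)
  split=> //=.
  - by move=> j k; rewrite /= ffunE.
  - by move=> j k; rewrite /= ffunE.
  - exact/priority_queue_enqueue_all/isT/lex_le_total.
  - by move=> h; rewrite memQ0 => /mapP[k _ ->]; rewrite mem_lex_cells cols_in_grid.
  - by move=> k _; rewrite memQ0 map_f // mem_enum.
  - by move=> k; rewrite mem_lex_cells cols_in_grid.
have LW_out : LW_run M LW_cell (qout b) by exists (qst b).
have queue_out : queue_run M emit (qout b) by exists b.
exists (qout b) => o; split; split=> [run|-> //].
  exact: LW_run_fun LW_out.
exact: queue_run_fun queue_out.
Qed.

End Emission.

(** * Min_gens as a single pass over the row *)

Lemma row_columns_split g : row_columns g =
  cols_such_that M (fun h => (h.1 < g.1) && (h.2 == g.2)) ++ cols_such_that M (pred1 g).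
Proof.
have lt_trans : transitive (fun i j : 'I_n => i < j) by move=> i j k; apply: ltn_trans.
apply: (irr_sorted_eq lt_trans) => [i|||k]; first exact: ltnn.
- by rewrite (sorted_pairwise lt_trans) cols_such_that_increasing.
- rewrite (sorted_pairwise lt_trans) pairwise_cat !cols_such_that_increasing !andbT.
  apply/allrelP => i j; rewrite !mem_cols_such_that => /andP[i_x /eqP i_y] /eqP j_g.
  (* Within a row, colex order lists smaller x-grades first. *)
  rewrite ltnNge; apply: contraL i_x => /(cols_colex M).
  by rewrite /colex_le lex_leE /= j_g i_y; lia.
rewrite mem_cat !mem_cols_such_that /=.
by case: (col_grade M k) g => [x y] [x' y']; rewrite xpair_eqE /=; lia.
Qed.

(** The grade test in the emission replaces the split into a silent and an emitting pass. *)
Lemma min_gens_LW_cellE g a b :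
  min_gens_LW_cell M g a b <-> LW_cell (emit_nonzero_of_grade M) g a b.
Proof.
rewrite /LW_cell row_columns_split for_each_cat.
have old s t : for_each (reduce_emit (@emit_nothing m n) g)
      (cols_such_that M (fun h => (h.1 < g.1) && (h.2 == g.2))) s t <->
    for_each (reduce_emit (emit_nonzero_of_grade M) g)
      (cols_such_that M (fun h => (h.1 < g.1) && (h.2 == g.2))) s t.
  apply: eq_in_for_each => i {}s {}t; rewrite mem_cols_such_that => /andP[i_x _].
  rewrite /reduce_emit /emit_nonzero_of_grade ifN //.
  by apply: contraTneq i_x => ->; rewrite ltnn.
have new s t : for_each (reduce_emit (@emit_nonzero m n) g) (cols_such_that M (pred1 g)) s t <->
    for_each (reduce_emit (emit_nonzero_of_grade M) g) (cols_such_that M (pred1 g)) s t.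
  apply: eq_in_for_each => i {}s {}t; rewrite mem_cols_such_that => i_g.
  by rewrite /reduce_emit /emit_nonzero_of_grade ifT.
by split=> -[c /old ac /new cb]; exists c.
Qed.

Lemma min_gens_LWE o :
  min_gens_LW M o <-> LW_run M (LW_cell (emit_nonzero_of_grade M)) o.
Proof.
have cells := eq_in_for_each
  (fun g a b (_ : g \in lex_cells X Y) => min_gens_LW_cellE g a b).
by split=> -[s /cells so]; exists s.
Qed.

End Simulation.

(** Programs are relations, so equivalence with [o = out] expresses termination and uniqueness of
    the output; sharing [out] expresses agreement. *)
Theorem propositionB3 (m n X Y : nat) (M : graded_matrix m n X Y) :
  (exists out : output m,
     (forall o : output m, min_gens_LW M o <-> o = out) /\
     (forall o : output m, min_gens_queue M o <-> o = out)) /\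
  (exists out : output n,
     (forall o : output n, ker_basis_LW M o <-> o = out) /\
     (forall o : output n, ker_basis_queue M o <-> o = out)).
Proof.
split.
  have [|out outP] := LW_queue_agree (M := M) (emit := emit_nonzero_of_grade M).
    by move=> g i s /negPf ig; rewrite /emit_nonzero_of_grade ig.
  by exists out; split=> o; rewrite ?min_gens_LWE; case: (outP o).
have [|out outP] := LW_queue_agree (M := M) (emit := @emit_kernel m n).
  (* With equal states before and after, no column turns from non-zero to zero. *)
  by move=> g i s _; rewrite /emit_kernel andNb.
by exists out; split=> o; case: (outP o).
Qed.
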